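(* Suppose $n\geq 2$ and $k\ge2$ are integers. There exists a universal constant $c>0$ such that, for any integer $D\ge1$, $$\inf_{\widehat M\in\mathbb R[A]^{n\times n}_{\le D}}\ \sup_{M\in\mathcal M_k}\ \mathbb E\big(\ell(\widehat M,M)\big)\ \ge\ \frac{c}{D^4}\left(\frac kn\wedge\frac1k\right).$$
   Context: $[k]=\{1,\dots,k\}$, $a\wedge b=\min(a,b)$. The stochastic block model (SBM) class is $$\mathcal M_k=\{M\in[0,1]^{n\times n}: M_{ii}=0\ (i\in[n]),\ M_{ij}=M_{ji}=Q_{z_iz_j}\ (i\ne j)\ \text{for some } Q=Q^\top\in[0,1]^{k\times k},\ z\in[k]^n\}.$$ Given $M$, one observes a symmetric adjacency matrix $A\in\{0,1\}^{n\times n}$ with $A_{ii}=0$ and $A_{ij}=A_{ji}\sim\mathrm{Bernoulli}(M_{ij})$ independent over $1\le i<j\le n$; $\mathbb E$ is over $A$ given $M$. The loss is $\ell(\widehat M,M)=\binom n2^{-1}\sum_{1\le i<j\le n}(\widehat M_{ij}-M_{ij})^2$. The notation $\widehat M\in\mathbb R[A]^{n\times n}_{\le D}$ means that every entry $\widehat M_{ij}$ is a real polynomial of degree at most $D$ in the entries of $A$. ''Universal'' means not depending on $n,k,D$. *)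

(* Defs.v *)
From HB Require Import structures.
(* mpoly has to be imported before the analysis files: the other order is a
   notation conflict. *)
From mathcomp Require Import all_boot all_order all_algebra.
From mathcomp Require Import mpoly.
From mathcomp Require Import all_classical all_reals ereal.
From mathcomp Require Import bernoulli_distribution.

Set Implicit Arguments.
Unset Strict Implicit.
Unset Printing Implicit Defensive.

Import Order.TTheory GRing.Theory Num.Theory.

Local Open Scope classical_set_scope.
Local Open Scope ring_scope.

Definition SBM (R : realType) (n k : nat) : set 'M[R]_n :=
  [set M | (forall i j, 0 <= M i j <= 1) /\ (forall i, M i i = 0) /\
     exists Q : 'M[R]_k, exists z : 'I_n -> 'I_k,
       [/\ Q = Q^T, forall a b, 0 <= Q a b <= 1
         & forall i j, i != j ->
             M i j = Q (z i) (z j) /\ M j i = Q (z i) (z j)]].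

Definition adjacency (n : nat) (A : 'M[bool]_n) : bool :=
  (A == A^T) && [forall i, ~~ A i i].

(* Probability of the graph with adjacency matrix A when the edges i < j are
   independent Bernoulli (M i j). *)
Definition graph_pmf (R : realType) (n : nat) (M : 'M[R]_n) (A : 'M[bool]_n)
    : R :=
  \prod_(i < n) \prod_(j < n | (i < j)%N) bernoulli_pmf (M i j) (A i j).

Definition graph_expectation (R : realType) (n : nat) (M : 'M[R]_n)
    (f : 'M[bool]_n -> R) : R :=
  \sum_(A : 'M[bool]_n | adjacency A) graph_pmf M A * f A.

(* The edge indicators are independent under graph_pmf, with marginals
   bernoulli_pmf (M i j); f = 1 gives total mass 1. *)
Lemma graph_expectation_prod (R : realType) (n : nat) (M : 'M[R]_n)
    (f : 'I_n -> 'I_n -> bool -> R) :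
  graph_expectation M
    (fun A => \prod_(i < n) \prod_(j < n | (i < j)%N) f i j (A i j)) =
  \prod_(i < n) \prod_(j < n | (i < j)%N)
    \sum_(b : bool) bernoulli_pmf (M i j) b * f i j b.
Proof.
rewrite pair_big_dep /= (big_distr_big false) /=.
pose g (A : 'M[bool]_n) := [ffun e : 'I_n * 'I_n => (e.1 < e.2)%N && A e.1 e.2].
pose h (u : {ffun 'I_n * 'I_n -> bool}) : 'M[bool]_n :=
  \matrix_(i, j) (u (i, j) || u (j, i)).
rewrite [RHS](reindex_onto g h) /=; last first.
  move=> u /pffun_onP[/fintype.subsetP su _]; apply/ffunP => -[i j]; rewrite !ffunE mxE /=.
  have us a b : u (a, b) -> (a < b)%N.
    by move=> uab; have := su (a, b); rewrite !inE uab => /(_ isT).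
  case: (ltnP i j) => ij /=.
    by case uji: (u (j, i)); rewrite ?orbF //; move/us: uji; rewrite ltnNge ltnW.
  by apply/esym/negbTE/negP => /us; rewrite ltnNge ij.
apply: eq_big => [A|A Aadj].
  rewrite [X in _ = X && _](_ : _ = true) ?andTb; last first.
    apply/pffun_onP; split; last by [].
    apply/fintype.subsetP => -[i j]; rewrite !unfold_in /= ffunE /=; by case: (i < j)%N.
  apply/andP/eqP => [[/eqP As /forallP A0]|<-].
    apply/matrixP => i j; rewrite mxE !ffunE /= [in A j i]As mxE.
    by case: ltngtP => //= [|/val_inj <-]; rewrite ?orbF //; rewrite (negbTE (A0 _)).
  split; first by apply/eqP/matrixP => i j; rewrite !mxE orbC.
  by apply/forallP => i; rewrite mxE !ffunE /= ltnn.
rewrite /graph_pmf !pair_big_dep -big_split /=; apply: eq_bigr => -[i j] /= ij.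
by rewrite ffunE /= ij.
Qed.

Definition loss (R : realType) (n : nat) (Mhat M : 'M[R]_n) : R :=
  'C(n, 2)%:R^-1 *
    \sum_(i < n) \sum_(j < n | (i < j)%N) (Mhat i j - M i j) ^+ 2.

(* The n * n indeterminates stand for the entries of A, in the order of mxvec;
   msize is the total degree plus one, and 0 on the zero polynomial. *)
Definition low_degree (R : realType) (n D : nat)
    : set 'M[{mpoly R[n * n]}]_n :=
  [set P | forall i j, (msize (P i j) <= D.+1)%N].

Definition estimate (R : realType) (n : nat) (P : 'M[{mpoly R[n * n]}]_n)
    (A : 'M[bool]_n) : 'M[R]_n :=
  \matrix_(i, j)
    (P i j).@[mxvec (map_mx (fun b : bool => b%:R : R) A) ord0].

Definition risk (R : realType) (n : nat) (P : 'M[{mpoly R[n * n]}]_n)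
    (M : 'M[R]_n) : R :=
  graph_expectation M (fun A => loss (estimate P A) M).

Arguments SBM R n k : clear implicits.
Arguments low_degree R n D : clear implicits.

(* Main.v *)
(* The supremum is bounded below by the average over the planted partition
   prior: [z] uniform in [K]^n and M_ij = (1 + theta 1{z_i = z_j}) / 2, with
   K = min(k, sqrt(2n)) up to rounding and theta^2 of order K^2 / (n D^4).
   Fix a pair e0, let x be the indicator that z is constant on e0, and write
   A in terms of the spins Y = 2A - 1, of conditional mean X = theta 1{z_i = z_j}.
   If h is a function of (z, A) with E(f h) = E(f x) for every f(A) of degree
   at most D, then E(f - x)^2 >= E(x^2) - E(h^2) for all these f.  Following
   Schramm and Wein, h is taken in the span of the products, over the edges e
   of a graph a, of (Y_e - X_e) / (1 - X_e^2), which are orthogonal given z; the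
   constraints then force the coefficients to be theta^|a| times the joint
   cumulants of x and the edge indicators of a.  These vanish when some
   component of a is disjoint from e0, and are at most (4D)^|a| times the
   probability that z is constant along a and e0.  Adding one edge at a time to
   the empty graph, the choice of theta makes E(h^2) a geometric series with
   ratio 1/4 and first term 1/K^2, whereas E(x^2) = 1/K. *)

Require Import Defs.
From mathcomp Require Import all_boot all_order all_algebra.
From mathcomp Require Import mpoly.
From mathcomp Require Import fingroup.
From mathcomp Require Import all_classical all_reals ereal.
From mathcomp Require Import bernoulli_distribution.
From mathcomp Require Import ring lra zify.

Set Implicit Arguments.
Unset Strict Implicit.
Unset Printing Implicit Defensive.

Import Order.TTheory GRing.Theory Num.Theory.

Local Open Scope ring_scope.

(** * Counting the colourings that are constant along a set of edges *)

Section Colourings.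
Variables n k : nat.

(** There are [k.+1] colours, so that ['I_k.+1] is a cyclic group and the colourings form a finite
    abelian group under addition. *)
Local Notation colouring := 'rV['I_k.+1]_n.
Local Notation edges := {set 'I_n * 'I_n}.

Definition mono (z : colouring) (e : 'I_n * 'I_n) : bool :=
  z ord0 e.1 == z ord0 e.2.

Definition monos (A : edges) : {set colouring} :=
  [set z | [forall e in A, mono z e]].

Lemma monosP (A : edges) (z : colouring) :
  reflect (forall e, e \in A -> mono z e) (z \in monos A).
Proof. by rewrite inE; apply: (iffP forall_inP). Qed.

Lemma monosU (A B : edges) : monos (A :|: B) = monos A :&: monos B.
Proof.
apply/setP => z; rewrite finset.in_setI; apply/monosP/andP => [zAB|[/monosP zA /monosP zB] e].
  by split; apply/monosP => e eA; apply: zAB; rewrite inE eA ?orbT.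
by rewrite inE => /orP[/zA|/zB].
Qed.

Lemma monosD (A : edges) (x y : colouring) :
  x \in monos A -> y \in monos A -> x + y \in monos A.
Proof.
move=> /monosP xA /monosP yA; apply/monosP => e eA.
by rewrite /mono !mxE (eqP (xA _ eA)) (eqP (yA _ eA)).
Qed.

Lemma monos0 (A : edges) : (0 : colouring) \in monos A.
Proof. by apply/monosP => e _; rewrite /mono !mxE. Qed.

Lemma monos_group_set (A : edges) : group_set (monos A).
Proof. by apply/group_setP; split=> [|x y]; [exact: monos0|exact: monosD]. Qed.

Canonical monos_group (A : edges) := Group (monos_group_set A).

(* The colourings constant along the edges of [A] form a subgroup of
   [(Z/k)^n], and [monos A :&: monos B = monos (A :|: B)]. *)
Lemma card_monosM (A B : edges) :
  (#|monos A| * #|monos B| =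
   #|(monos A * monos B)%g| * #|monos (A :|: B)|)%N.
Proof. by rewrite monosU; exact: (mul_cardG [group of monos A] [group of monos B]). Qed.

Lemma card_colouring : #|{: colouring}| = (k.+1 ^ n)%N.
Proof. by rewrite card_mx card_ord mul1n. Qed.

(** Positive correlation of the two events: a product of two subgroups has at most as many elements
    as the whole group. *)
Lemma leq_card_monosM (A B : edges) :
  (#|monos A| * #|monos B| <= k.+1 ^ n * #|monos (A :|: B)|)%N.
Proof. by rewrite card_monosM leq_mul2r -card_colouring max_card orbT. Qed.

(** If the two subgroups together generate every colouring, the product formula becomes exact
    independence of the two events. *)
Lemma card_monos_indep (A B : edges) :
  (forall z, exists2 x, x \in monos A & z - x \in monos B) ->
  (#|monos A| * #|monos B| = k.+1 ^ n * #|monos (A :|: B)|)%N.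
Proof.
move=> AB; rewrite card_monosM -card_colouring; congr (_ * _)%N.
apply: eq_card => z; rewrite inE; have [x xA zxB] := AB z.
by apply/mulsgP; exists x (z - x) => //; rewrite [RHS]addrC subrK.
Qed.

Definition endpoints (A : edges) : {set 'I_n} := fst @: A :|: snd @: A.

Lemma endpointsP (A : edges) (v : 'I_n) :
  reflect (exists2 e, e \in A & (e.1 == v) || (e.2 == v)) (v \in endpoints A).
Proof.
rewrite inE; apply: (iffP orP).
  by move=> [|] /imsetP[e eA ->]; exists e; rewrite ?eqxx ?orbT.
move=> [e eA /orP[] /eqP <-]; [left|right]; exact: imset_f.
Qed.

Lemma endpoints1 (A : edges) e : e \in A -> e.1 \in endpoints A.
Proof. by move=> eA; apply/endpointsP; exists e; rewrite ?eqxx. Qed.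

Lemma endpoints2 (A : edges) e : e \in A -> e.2 \in endpoints A.
Proof. by move=> eA; apply/endpointsP; exists e; rewrite ?eqxx ?orbT. Qed.

Lemma endpointsU (A B : edges) :
  endpoints (A :|: B) = endpoints A :|: endpoints B.
Proof. by rewrite /endpoints !imsetU finset.setUACA. Qed.

Lemma card_endpoints (A : edges) : (#|endpoints A| <= #|A|.*2)%N.
Proof.
apply: leq_trans (leq_card_setU _ _) _.
by rewrite -addnn leq_add ?leq_imset_card.
Qed.

(** Split [z] into its restriction off the endpoints of [A], which is zero along [A], and its
    restriction to them, which is zero along [B]. *)
Lemma card_monos_disjoint (A B : edges) :
  [disjoint endpoints A & endpoints B] ->
  (#|monos A| * #|monos B| = k.+1 ^ n * #|monos (A :|: B)|)%N.
Proof.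
move=> dAB; apply: card_monos_indep => z.
exists (\row_v (if v \in endpoints A then 0 else z ord0 v)).
  by apply/monosP => e eA; rewrite /mono !mxE endpoints1 ?endpoints2.
apply/monosP => e eB; rewrite /mono !mxE.
by rewrite !(disjointFl dAB) ?endpoints1 ?endpoints2 // !subrr.
Qed.

(** Recolouring [u] alone is invisible to [A] and can always give [u] the colour of [v]. *)
Lemma card_monos_fresh (A : edges) e u v : u \notin endpoints A -> u != v ->
  (e = (u, v) \/ e = (v, u)) ->
  (#|monos A| * #|monos [set e]| = k.+1 ^ n * #|monos (A :|: [set e])|)%N.
Proof.
move=> uA uv ee; apply: card_monos_indep => z.
exists (\row_w (if w == u then z ord0 u - z ord0 v else 0)).
  apply/monosP => f fA; rewrite /mono !mxE.
  have f1 : f.1 != u by apply: contraNneq uA => <-; exact: endpoints1.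
  have f2 : f.2 != u by apply: contraNneq uA => <-; exact: endpoints2.
  by rewrite (negbTE f1) (negbTE f2).
have vu : (v == u) = false by rewrite eq_sym (negbTE uv).
apply/monosP => f /finset.set1P ->.
by case: ee => ->; rewrite /mono !mxE /= eqxx vu subr0 opprB addrC subrK.
Qed.

(** Every colouring is uniquely a colouring constant on [e] plus a shift of the colour of [e.1]. *)
Lemma card_monos1 (e : 'I_n * 'I_n) : e.1 != e.2 ->
  (k.+1 * #|monos [set e]| = k.+1 ^ n)%N.
Proof.
case: e => u v /= uv; rewrite -card_colouring -cardsT.
pose f (p : 'I_k.+1 * colouring) : colouring :=
  p.2 + \row_w (if w == u then p.1 else 0).
have vu : (v == u) = false by rewrite eq_sym (negbTE uv).
have <- : f @: finset.setX [set: 'I_k.+1] (monos [set (u, v)]) = [set: colouring].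
  apply/setP => z; rewrite inE; apply/imsetP.
  exists (z ord0 u - z ord0 v, z - \row_w (if w == u then z ord0 u - z ord0 v else 0)).
    rewrite !inE /=; apply/forall_inP => _ /finset.set1P ->.
    by rewrite /mono !mxE /= eqxx vu subr0 opprB addrC subrK.
  by rewrite /f /= subrK.
rewrite card_in_imset ?cardsX ?cardsT ?card_ord //.
move=> [a x] [b y]; rewrite !inE /= => /forall_inP xm /forall_inP ym xy.
have /eqP := xm _ (set11 _); have /eqP := ym _ (set11 _); rewrite /= => yuv xuv.
have ab : a = b.
  have /rowP xyw := xy; have := xyw u; have := xyw v.
  rewrite !mxE vu eqxx /= !addr0 xuv yuv => ->; exact: addrI.
by move: xy; rewrite /f ab /= => /addIr ->.
Qed.

End Colourings.

(** * Sums over subsets and over images *)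

Section SubsetSums.
Variables (R : realType) (T : finType).

Lemma prod1D_subset (F : T -> R) (B : {set T}) :
  \prod_(i in B) (1 + F i) =
  \sum_(A : {set T} | A \subset B) \prod_(i in A) F i.
Proof.
transitivity (\prod_i ((if i \in B then F i else 0) + 1)).
  rewrite big_mkcond; apply: eq_bigr => i _.
  by case: ifP; rewrite ?add0r // addrC.
rewrite bigA_distr [RHS]big_mkcond /=; apply: eq_bigr => J _.
case: ifPn => [/fintype.subsetP JB|/fintype.subsetPn[i iJ iB]].
  rewrite [RHS]big_mkcond; apply: eq_bigr => i _.
  by case: ifPn => // /JB ->.
by rewrite (bigD1 i) //= iJ (negbTE iB) mul0r.
Qed.

Lemma sum_expr_subset (x : R) (B : {set T}) :
  \sum_(A : {set T} | A \subset B) x ^+ #|A| = (1 + x) ^+ #|B|.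
Proof.
rewrite -prodr_const prod1D_subset.
by apply: eq_bigr => A _; rewrite prodr_const.
Qed.

(** Needed for enumerations that reach the same object several times: overcounting nonnegative terms
    only increases the sum. *)
Lemma ler_sum_imset (U : finType) (h : U -> T) (A : {set U}) (F : T -> R) :
  (forall x, 0 <= F x) ->
  \sum_(x in h @: A) F x <= \sum_(a in A) F (h a).
Proof.
move=> F0; rewrite (partition_big_imset h) /=; apply: ler_sum => _ /imsetP[a aA ->].
by rewrite (bigD1 a) ?aA ?eqxx //= lerDl sumr_ge0.
Qed.

End SubsetSums.

(** * The probability that a uniform colouring is constant along an edge set *)

Section MonoProbability.
Variables (R : realType) (n k : nat).

Local Notation edges := {set 'I_n * 'I_n}.

Definition mono_prob (A : edges) : R :=
  #|monos k A|%:R / (k.+1 ^ n)%:R.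

Let kn_neq0 : (k.+1 ^ n)%:R != 0 :> R.
Proof. by rewrite pnatr_eq0 expn_eq0. Qed.

Let kn_gt0 : 0 < (k.+1 ^ n)%:R :> R.
Proof. by rewrite ltr0n expn_gt0. Qed.

Lemma mono_prob_ge0 (A : edges) : 0 <= mono_prob A.
Proof. by rewrite divr_ge0. Qed.

Lemma mono_prob0 : mono_prob finset.set0 = 1.
Proof.
rewrite /mono_prob -card_colouring -cardsT.
have -> : monos k (finset.set0 : edges) = [set: 'rV_n].
  by apply/setP => z; rewrite [RHS]inE; apply/monosP => e; rewrite inE.
by rewrite divff // cardsT card_colouring.
Qed.

Lemma mono_prob_anti (A B : edges) : A \subset B -> mono_prob B <= mono_prob A.
Proof.
move=> /fintype.subsetP AB; rewrite ler_wpM2r ?invr_ge0 ?ler_nat ?ler0n //.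
by apply: subset_leq_card; apply/fintype.subsetP => z /monosP zB; apply/monosP => e /AB /zB.
Qed.

Lemma mono_probM_le (A B : edges) :
  mono_prob A * mono_prob B <= mono_prob (A :|: B).
Proof.
rewrite /mono_prob mulrACA -natrM mulrA ler_wpM2r ?invr_ge0 ?ler0n //.
by rewrite ler_pdivrMr // -natrM ler_nat [leqRHS]mulnC leq_card_monosM.
Qed.

Let mono_probM (A B : edges) :
  (#|monos k A| * #|monos k B| = k.+1 ^ n * #|monos k (A :|: B)|)%N ->
  mono_prob (A :|: B) = mono_prob A * mono_prob B.
Proof.
move=> AB; rewrite /mono_prob mulrACA -natrM AB natrM.
by rewrite mulrACA mulfV // mul1r.
Qed.

Lemma mono_prob_disjoint (A B : edges) :
  [disjoint endpoints A & endpoints B] ->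
  mono_prob (A :|: B) = mono_prob A * mono_prob B.
Proof. by move=> dAB; apply/mono_probM/card_monos_disjoint. Qed.

Lemma mono_prob1 (e : 'I_n * 'I_n) : e.1 != e.2 ->
  mono_prob [set e] = k.+1%:R^-1.
Proof.
move=> /(card_monos1 k) ke; rewrite /mono_prob -ke natrM invfM mulrCA mulfV ?mulr1 //.
by apply: contraNneq kn_neq0 => c0; rewrite -ke natrM c0 mulr0.
Qed.

Lemma mono_prob_fresh (A : edges) e u v : u \notin endpoints A -> u != v ->
  e = (u, v) \/ e = (v, u) ->
  mono_prob (A :|: [set e]) = mono_prob A / k.+1%:R.
Proof.
move=> uA uv ee; rewrite mono_probM ?(card_monos_fresh k uA uv ee) //.
by rewrite mono_prob1 //; case: ee => -> //=; rewrite eq_sym.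
Qed.

End MonoProbability.

(** * Joint cumulants and their size *)

Section Cumulants.
Variables (R : realType) (n k : nat) (e0 : 'I_n * 'I_n).

Local Notation edges := {set 'I_n * 'I_n}.
Local Notation P := (@mono_prob R n k).

(** The fuel [d] makes the recursion on proper subsets structural; as long as [#|b| < d], the
    default value 0 is never reached. *)
Fixpoint cumulant_rec (d : nat) (b : edges) : R :=
  if d is d'.+1 then
    P (e0 |: b) - \sum_(a : edges | a \proper b) cumulant_rec d' a * P (b :\: a)
  else 0.

(* Joint cumulant of the indicator of [mono z e0] and the indicators of
   [mono z e] for [e \in b], [z] being uniform. *)
Definition cumulant (b : edges) : R := cumulant_rec #|b|.+1 b.

Lemma cumulant_rec_stable d d' (b : edges) : (#|b| < d)%N -> (#|b| < d')%N ->
  cumulant_rec d b = cumulant_rec d' b.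
Proof.
elim: d d' b => [//|d IH] [//|d'] b; rewrite !ltnS => bd bd' /=.
congr (_ - _); apply: eq_bigr => a /proper_card ab.
by rewrite (IH d') // (leq_trans ab).
Qed.

Lemma cumulantE (b : edges) :
  cumulant b =
  P (e0 |: b) - \sum_(a : edges | a \proper b) cumulant a * P (b :\: a).
Proof.
rewrite /cumulant /=; congr (_ - _); apply: eq_bigr => a /proper_card ab.
by rewrite (@cumulant_rec_stable _ #|a|.+1).
Qed.

(** The moment-cumulant formula, sorted by the block that contains the indicator of [e0]. *)
Lemma sum_cumulant (b : edges) :
  \sum_(a : edges | a \subset b) cumulant a * P (b :\: a) = P (e0 |: b).
Proof.
rewrite (bigD1 b) //= finset.setDv mono_prob0 mulr1 [X in X + _]cumulantE.
rewrite (eq_bigl (fun a : edges => a \proper b)) ?subrK // => a.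
by rewrite finset.properEneq andbC.
Qed.

(** Induction on [#|b|]: positive correlation bounds each product in the recursion by a multiple of
    [P (e0 |: b)], and the powers of [4 * D] are summed by the binomial formula. *)
Lemma cumulant_bound (D : nat) (b : edges) : (0 < D)%N -> (#|b| <= D)%N ->
  `|cumulant b| <= (4 * D)%:R ^+ #|b| * P (e0 |: b).
Proof.
move=> D0; have [m] := ubnP #|b|; elim: m b => // m IH b bm bD.
set B : R := (4 * D)%:R; set l := #|b|.
have B4 : 4 <= B by rewrite /B ler_nat leq_pmulr.
have lB : l%:R * 4 <= B by rewrite /B -natrM ler_nat mulnC leq_mul2l.
have Pb := mono_prob_ge0 R k (e0 |: b).
rewrite cumulantE; apply: le_trans (ler_normB _ _) _.
rewrite ger0_norm //.
have : `|\sum_(a : edges | a \proper b) cumulant a * P (b :\: a)| <=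
       ((1 + B) ^+ l - B ^+ l) * P (e0 |: b).
  apply: le_trans (ler_norm_sum _ _ _) _.
  rewrite -sum_expr_subset [in leRHS](bigD1 b) //= [in leRHS]addrAC subrr add0r mulr_suml.
  rewrite [X in _ <= X](eq_bigl (fun a : edges => a \proper b)); last first.
    by move=> a; rewrite finset.properEneq andbC.
  apply: ler_sum => a ab; rewrite normrM (ger0_norm (mono_prob_ge0 _ _ _)).
  have al := proper_card ab.
  apply: le_trans (ler_wpM2r (mono_prob_ge0 _ _ _) (IH a _ _)) _.
  - exact: leq_trans al _.
  - exact: leq_trans (ltnW al) _.
  rewrite -mulrA ler_wpM2l ?exprn_ge0 ?ler0n //.
  apply: le_trans (mono_probM_le _ _ _ _) _.
  rewrite -finset.setUA; have -> // : a :|: (b :\: a) = b.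
  by rewrite -[RHS](finset.setID b a) (finset.setIidPr (proper_sub ab)).
move=> /(lerD (lexx (P (e0 |: b)))) /le_trans; apply.
rewrite -{1}[P _]mul1r -mulrDl ler_wpM2r //.
have [l0|l0] := posnP l; first by rewrite l0 !expr0 subrr addr0.
suff : (1 + B) ^+ l + 1 <= 2 * B ^+ l by lra.
(* A Bernoulli-type inequality. At [j = l], with [4 * l <= B], it gives
   [(1 + B) ^+ l <= 4 / 3 * B ^+ l]; the remaining 1 is absorbed because [B ^+ l >= 4]. *)
have pBE j : (B - j%:R) * (1 + B) ^+ j <= B * B ^+ j.
  elim: j => [|j IHj]; first by rewrite !expr0 subr0.
  rewrite [in leRHS]exprS mulrCA; apply: le_trans (ler_wpM2l _ IHj); last by lra.
  have : 0 <= (1 + B) ^+ j by rewrite exprn_ge0 //; lra.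
  rewrite exprS -natr1; have : (0 : R) <= j%:R by [].
  by move: (j%:R) ((1 + B) ^+ j) => x y x0 y0; nra.
have := pBE l; have : 4 <= B ^+ l.
  by rewrite -(prednK l0) exprS; have : 1 <= B ^+ l.-1; [rewrite exprn_ege1 //; lra|nra].
by move: (B ^+ l) ((1 + B) ^+ l) lB B4 (ler0n R l) => x y; nra.
Qed.

End Cumulants.

(** * Vanishing of cumulants and summation over connected edge sets *)

Section GrownSets.
Variables (R : realType) (n k : nat) (e0 : 'I_n * 'I_n).

Local Notation edges := {set 'I_n * 'I_n}.
Local Notation P := (@mono_prob R n k).
Local Notation cumulant := (cumulant R k e0).

Lemma endpointsS (A B : edges) : A \subset B -> endpoints A \subset endpoints B.
Proof. by move=> /finset.setUidPr <-; rewrite endpointsU finset.subsetUl. Qed.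

(** Induction on [#|b|]. Proper subsets meeting [c] have zero cumulant; those inside [b :\: c]
    contribute [P (e0 |: b :\: c) * P c], which by independence is the whole moment
    [P (e0 |: b)]. *)
Lemma cumulant_eq0 (b c : edges) : c \subset b -> c != finset.set0 ->
  [disjoint endpoints (e0 |: b :\: c) & endpoints c] -> cumulant b = 0.
Proof.
have [m] := ubnP #|b|; elim: m b c => // m IH b c bm cb c0 dbc.
have bcU : b = (b :\: c) :|: c.
  by rewrite -[LHS](finset.setID b c) finset.setUC (finset.setIidPr cb).
have dsub (a : edges) : a \subset b :\: c ->
    [disjoint endpoints (b :\: c :\: a) & endpoints c].
  move=> abc; apply: disjointWl dbc; apply: endpointsS.
  exact: fintype.subset_trans (finset.subsetDl _ _) (finset.subsetUr _ _).
rewrite cumulantE (bigID (fun a : edges => a \subset b :\: c)) /=.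
rewrite [X in _ - (_ + X)]big1 ?addr0; last first.
  move=> a /andP[ab abc]; rewrite (IH a (a :&: c)) ?mul0r //.
  - exact: leq_trans (proper_card ab) _.
  - exact: finset.subsetIl.
  - apply: contraNneq abc => ac0; rewrite finset.subsetD (proper_sub ab) /=.
    by rewrite -finset.setI_eq0 ac0.
  - apply: disjointW dbc; apply: endpointsS; last exact: finset.subsetIr.
    apply: finset.setUS; apply/fintype.subsetP => x; rewrite !inE negb_and.
    case xa: (x \in a); rewrite ?andbF //= andbT => ->.
    by rewrite (fintype.subsetP (proper_sub ab)).
rewrite (eq_bigl (fun a : edges => a \subset b :\: c)); last first.
  move=> a; apply/andP/idP => [[]//|abc]; split=> //.
  apply: sub_proper_trans abc _.
  rewrite properE finset.subsetDl /=; apply: contra c0 => bbc.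
  rewrite -finset.subset0; apply/fintype.subsetP => x xc.
  have := fintype.subsetP bbc x (fintype.subsetP cb x xc).
  by rewrite !inE xc.
rewrite (eq_bigr (fun a => cumulant a * P (b :\: c :\: a) * P c)); last first.
  move=> a abc; rewrite -mulrA -mono_prob_disjoint ?dsub //; congr (_ * P _).
  apply/setP => x; have := fintype.subsetP abc x; have := fintype.subsetP cb x.
  by rewrite !inE; case: (x \in a); case: (x \in b); case: (x \in c) => //= h1 h2;
    rewrite ?(h1 isT) //; move: (h2 isT).
rewrite -mulr_suml sum_cumulant {1}bcU finset.setUA mono_prob_disjoint //.
by rewrite subrr.
Qed.

Definition adjacent_edges (a : edges) : edges :=
  [set e | (e.1 \in endpoints (e0 |: a)) || (e.2 \in endpoints (e0 |: a))] :\: a.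

(* Sums over connected edge sets are bounded through this enumeration, one edge
   at a time, so that connected graphs never have to be counted. *)
Fixpoint grown (l : nat) : {set edges} :=
  if l is l'.+1 then
    [set p.2 |: p.1 | p in
      [set p : edges * ('I_n * 'I_n) | (p.1 \in grown l') && (p.2 \in adjacent_edges p.1)]]
  else [set finset.set0].

Lemma grownS l a e : a \in grown l -> e \in adjacent_edges a ->
  e |: a \in grown l.+1.
Proof. by move=> al ea; apply/imsetP; exists (a, e); rewrite // inE al ea. Qed.

Lemma card_grown l a : a \in grown l -> #|a| = l.
Proof.
elim: l a => [|l IH] a /=; first by rewrite inE => /eqP ->; rewrite finset.cards0.
move=> /imsetP[[b e]]; rewrite inE /= => /andP[/IH bl].
by rewrite inE => /andP[eb _] ->; rewrite cardsU1 eb bl.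
Qed.

(** Take a largest grown subset [a] of [b]. By maximality no edge of [b :\: a] touches [e0 |: a], so
    [b :\: a] splits off as in [cumulant_eq0]. *)
Lemma cumulant_grown (b : edges) : b \notin grown #|b| -> cumulant b = 0.
Proof.
pose p l := [exists a in grown l, a \subset b].
have p0 : exists l, p l.
  exists 0%N; apply/existsP; exists finset.set0.
  by rewrite /= inE eqxx finset.sub0set.
have pb l : p l -> (l <= #|b|)%N.
  by move=> /existsP[a /andP[/card_grown <- /subset_leq_card]].
case: (ex_maxnP p0 pb) => l /existsP[a /andP[al ab]] lmax bNg.
apply: (@cumulant_eq0 b (b :\: a)).
- exact: finset.subsetDl.
- apply: contra bNg; rewrite finset.setD_eq0 => ba.
  have <- : a = b by apply/eqP; rewrite finset.eqEsubset ab ba.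
  by rewrite (card_grown al).
rewrite finset.setDDr finset.setDv finset.set0U (finset.setIidPr ab).
rewrite disjoint_sym finset.disjoints_subset; apply/fintype.subsetP => v /endpointsP[e].
rewrite inE => /andP[ea eb] ev; rewrite inE; apply/negP => va.
suff /lmax : p l.+1 by rewrite ltnn.
apply/existsP; exists (e |: a); rewrite grownS //=; last first.
  rewrite finset.in_setD ea finset.in_set.
  by case/orP: ev => /eqP ->; rewrite va ?orbT.
by apply/fintype.subsetP => x /finset.setU1P[->//|/(fintype.subsetP ab)].
Qed.

(** An added edge either joins two old endpoints, and the probability does not increase, or has one
    fresh endpoint, and the probability is divided by the number of colours. *)
Lemma sum_adjacent_edges (a : edges) :
  \sum_(e in adjacent_edges a) P (e0 |: (e |: a)) ^+ 2 <=
  (#|endpoints (e0 |: a)| ^ 2)%:R * P (e0 |: a) ^+ 2 +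
  2 * (#|endpoints (e0 |: a)| * n)%:R * (P (e0 |: a) ^+ 2 / k.+1%:R ^+ 2).
Proof.
set V := endpoints (e0 |: a).
pose old := finset.setX V V.
pose new1 := finset.setX V (~: V); pose new2 := finset.setX (~: V) V.
have Psq0 (A : edges) : 0 <= P A ^+ 2 by rewrite exprn_ge0 ?mono_prob_ge0.
have Uea e : e0 |: (e |: a) = (e0 |: a) :|: [set e].
  by rewrite (finset.setUC _ a) finset.setUA.
have cardVC : (#|~: V| <= n)%N by rewrite -[leqRHS]card_ord max_card.
have : \sum_(e in adjacent_edges a) P (e0 |: (e |: a)) ^+ 2 <=
    \sum_(e in old) P (e0 |: a) ^+ 2 +
    (\sum_(e in new1) P (e0 |: a) ^+ 2 / k.+1%:R ^+ 2 +
     \sum_(e in new2) P (e0 |: a) ^+ 2 / k.+1%:R ^+ 2).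
  rewrite [X in X <= _]big_mkcond [X in _ <= X + _]big_mkcond.
  rewrite [X in _ <= _ + (X + _)]big_mkcond [X in _ <= _ + (_ + X)]big_mkcond.
  rewrite -!big_split /=; apply: ler_sum => -[u v] _.
  rewrite /adjacent_edges finset.in_setD finset.in_set !finset.in_setX /=.
  rewrite !finset.in_setC /= -/V Uea.
  have fresh x y : x \notin V -> y \in V -> (u, v) = (x, y) \/ (u, v) = (y, x) ->
      P ((e0 |: a) :|: [set (u, v)]) = P (e0 |: a) / k.+1%:R.
    move=> xV yV; apply: mono_prob_fresh => //.
    by apply: contraNneq xV => ->.
  case: (boolP (u \in V)) => uV; case: (boolP (v \in V)) => vV /=;
    rewrite ?andbT ?andbF ?addr0 ?add0r //.
  - case: ifP => // _; rewrite lerXn2r ?nnegrE ?mono_prob_ge0 //.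
    by rewrite mono_prob_anti // finset.subsetUl.
  - rewrite (fresh v u) //; last by right.
    by case: ifP => _; rewrite ?expr_div_n // divr_ge0 // exprn_ge0.
  - rewrite (fresh u v) //; last by left.
    by case: ifP => _; rewrite ?expr_div_n // divr_ge0 // exprn_ge0.
have sumc (S : {set 'I_n * 'I_n}) (x : R) : \sum_(e in S) x = #|S|%:R * x.
  by rewrite sumr_const mulr_natl.
move=> /le_trans; apply; rewrite !sumc !finset.cardsX.
apply: lerD; first by rewrite mulnn.
rewrite (mulnC #|~: V|) -mulrDl ler_wpM2r ?divr_ge0 ?exprn_ge0 ?mono_prob_ge0 //.
have : (#|V| * #|~: V|)%:R <= (#|V| * n)%:R :> R.
  by rewrite ler_nat leq_mul2l cardVC orbT.
by move=> h; rewrite [2]mulr2n mulrDl !mul1r lerD.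
Qed.

Definition grown_sum (rho : R) (l : nat) : R :=
  \sum_(a in grown l) rho ^+ l * P (e0 |: a) ^+ 2.

Lemma grown_sum_ge0 rho l : 0 <= rho -> 0 <= grown_sum rho l.
Proof.
by move=> rho0; apply: sumr_ge0 => a _; rewrite mulr_ge0 ?exprn_ge0 ?mono_prob_ge0.
Qed.

Lemma grown_sumS (rho : R) (D l : nat) : 0 <= rho -> (l < D)%N ->
  (k.+1 ^ 2 <= 2 * n)%N ->
  grown_sum rho l.+1 <=
  rho * (12 * D%:R ^+ 2 * n%:R / k.+1%:R ^+ 2) * grown_sum rho l.
Proof.
move=> rho0 lD kn; have Psq0 (A : edges) : 0 <= P A ^+ 2.
  by rewrite exprn_ge0 ?mono_prob_ge0.
rewrite /grown_sum /=; apply: le_trans (ler_sum_imset _ _ _) _.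
  by move=> a; rewrite mulr_ge0 ?exprn_ge0 ?mono_prob_ge0.
rewrite (eq_bigl (fun p => (p.1 \in grown l) && (p.2 \in adjacent_edges p.1))); last first.
  by move=> p; rewrite inE.
rewrite -(pair_big_dep (mem (grown l)) (fun a e => e \in adjacent_edges a)
  (fun a e => rho ^+ l.+1 * P (e0 |: (e |: a)) ^+ 2)) /=.
rewrite mulr_sumr; apply: ler_sum => a al.
rewrite -mulr_sumr exprS -[leLHS]mulrA -[leRHS]mulrA ler_wpM2l // [leRHS]mulrCA ler_wpM2l ?exprn_ge0 //.
apply: le_trans (sum_adjacent_edges a) _.
have : (#|endpoints (e0 |: a)| <= D.*2)%N.
  apply: leq_trans (card_endpoints _) _; rewrite leq_double.
  by apply: leq_trans (leq_card_setU _ _) _; rewrite finset.cards1 (card_grown al).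
move: #|endpoints _| => v vD.
have := Psq0 (e0 |: a); move: (P _ ^+ 2) => p p0.
rewrite [in leLHS]mulrCA [in leLHS]mulrC -mulrDr [leLHS]mulrC ler_wpM2r //.
have K0 : 0 < k.+1%:R ^+ 2 :> R by rewrite exprn_gt0.
rewrite ler_pdivlMr // mulrDl divfK ?gt_eqF //.
rewrite -!natrX -!natrM -natrD ler_nat.
(* The constant 12 is 8 + 4: with [v <= 2 * D], old pairs give
   [4 * D ^ 2 * k.+1 ^ 2 <= 8 * D ^ 2 * n], and fresh endpoints give
   [2 * v * n <= 4 * D ^ 2 * n]. *)
have v2D : (v ^ 2 <= 4 * D ^ 2)%N by rewrite -!mulnn; nia.
have vD2 : (v <= 2 * D ^ 2)%N by rewrite -mulnn; nia.
have := leq_mul v2D kn; have := leq_mul vD2 (leqnn n).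
by move: (v ^ 2 * _)%N (v * n)%N (D ^ 2)%N => x y z; lia.
Qed.

Lemma sum_grown_sum (rho : R) (D : nat) : 0 <= rho -> e0.1 != e0.2 ->
  (k.+1 ^ 2 <= 2 * n)%N ->
  rho * (12 * D%:R ^+ 2 * n%:R / k.+1%:R ^+ 2) <= 4^-1 ->
  \sum_(l < D.+1) grown_sum rho l <= 4 / 3 / k.+1%:R ^+ 2.
Proof.
move=> rho0 e0E kn eta4.
have T0 : grown_sum rho 0 = (k.+1%:R ^+ 2)^-1.
  by rewrite /grown_sum /= finset.big_set1 expr0 mul1r finset.setU0 mono_prob1 // exprVn.
have T l : (l <= D)%N -> grown_sum rho l <= 4^-1 ^+ l / k.+1%:R ^+ 2.
  elim: l => [|l IH] lD; first by rewrite T0 expr0 mul1r.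
  apply: le_trans (grown_sumS rho0 lD kn) _; rewrite (exprS 4^-1) -[leRHS]mulrA.
  apply: (ler_pM _ _ eta4 (IH (ltnW lD))); last exact: grown_sum_ge0.
  by rewrite mulr_ge0 // divr_ge0 ?mulr_ge0 ?exprn_ge0 ?ler0n.
have : \sum_(l < D.+1) grown_sum rho l <=
    \sum_(l < D.+1) 4^-1 ^+ l / k.+1%:R ^+ 2.
  by apply: ler_sum => i _; apply: T; rewrite -ltnS.
move=> /le_trans; apply.
rewrite -mulr_suml ler_wpM2r ?invr_ge0 ?exprn_ge0 //.
have := subrX1 (4^-1 : R) D.+1; have : 0 <= (4^-1 : R) ^+ D.+1 by rewrite exprn_ge0.
by move: (\sum_(i < _) _) (_ ^+ D.+1) => x y; lra.
Qed.

Lemma sum_cumulant_sq (tau : R) (D : nat) : 0 <= tau -> (0 < D)%N ->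
  e0.1 != e0.2 -> (k.+1 ^ 2 <= 2 * n)%N ->
  tau * (768 * D%:R ^+ 4 * n%:R / k.+1%:R ^+ 2) <= 1 ->
  \sum_(a : edges | (#|a| <= D)%N) tau ^+ #|a| * cumulant a ^+ 2 <=
  4 / 3 / k.+1%:R ^+ 2.
Proof.
move=> tau0 D0 e0E kn tauD.
(* The factor [(4 * D) ^ 2] per edge is the square of [cumulant_bound]; 768 is 16 times the 12 of
   [grown_sumS] times 4, so that the ratio is at most 1/4. *)
pose rho := tau * (4 * D)%:R ^+ 2.
have rho0 : 0 <= rho by rewrite mulr_ge0 ?exprn_ge0.
have eta4 : rho * (12 * D%:R ^+ 2 * n%:R / k.+1%:R ^+ 2) <= 4^-1.
  have -> : rho * (12 * D%:R ^+ 2 * n%:R / k.+1%:R ^+ 2) =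
      4^-1 * (tau * (768 * D%:R ^+ 4 * n%:R / k.+1%:R ^+ 2)).
    by rewrite /rho natrM; field; rewrite nat1r pnatr_eq0.
  by rewrite ler_piMr ?invr_ge0.
apply: le_trans (sum_grown_sum rho0 e0E kn eta4).
(* Sort by number of edges; [inord] loses nothing since [#|a| <= D]. *)
rewrite (partition_big (fun a : edges => inord #|a| : 'I_D.+1) predT) //=.
apply: ler_sum => l _; rewrite /grown_sum.
rewrite (bigID (fun a => a \in grown l)) /= [X in _ + X]big1 ?addr0; last first.
  move=> a /andP[/andP[aD /eqP <-]]; rewrite inordK ?ltnS // => /cumulant_grown ->.
  by rewrite expr0n mulr0.
rewrite [X in X <= _](eq_bigl (fun a => a \in grown l)); last first.
  move=> a; apply/andP/idP => [[]//|al]; rewrite al; split=> //.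
  by rewrite (card_grown al) -ltnS ltn_ord inord_val eqxx.
apply: ler_sum => a al; rewrite (card_grown al) /rho exprMn -mulrA ler_wpM2l ?exprn_ge0 //.
rewrite -exprM (mulnC 2) exprM -exprMn -[leLHS]real_normK ?num_real //.
rewrite lerXn2r ?nnegrE ?mulr_ge0 ?exprn_ge0 ?mono_prob_ge0 //.
by rewrite -(card_grown al) cumulant_bound // (card_grown al) -ltnS.
Qed.

End GrownSets.

(** * Expectation over the graph, and low-degree polynomials in spin form *)

Section GraphExpectation.
Variables (R : realType) (n : nat).

Local Notation edges := {set 'I_n * 'I_n}.

Definition pairs : edges := [set e : 'I_n * 'I_n | (e.1 < e.2)%N].

Lemma graph_expectation_pairs (M : 'M[R]_n) (F : 'I_n * 'I_n -> bool -> R) :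
  graph_expectation M (fun A => \prod_(e in pairs) F e (A e.1 e.2)) =
  \prod_(e in pairs)
    (M e.1 e.2 * F e true + (1 - M e.1 e.2) * F e false).
Proof.
have toP (G : 'I_n * 'I_n -> R) :
    \prod_(e in pairs) G e = \prod_(i < n) \prod_(j < n | (i < j)%N) G (i, j).
  rewrite pair_big_dep /=; apply: eq_big => [[i j]|[i j] _] //.
  by rewrite inE.
transitivity (graph_expectation M (fun A =>
    \prod_(i < n) \prod_(j < n | (i < j)%N) F (i, j) (A i j))).
  by rewrite /graph_expectation; apply: eq_bigr => A _; rewrite toP.
rewrite (graph_expectation_prod M (fun i j => F (i, j))) toP.
apply: eq_bigr => i _; apply: eq_bigr => j _.
by rewrite big_bool.
Qed.

Lemma eq_graph_expectation (M : 'M[R]_n) (f g : 'M[bool]_n -> R) :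
  (forall A, adjacency A -> f A = g A) ->
  graph_expectation M f = graph_expectation M g.
Proof. by move=> fg; apply: eq_bigr => A /fg ->. Qed.

Lemma graph_expectationD (M : 'M[R]_n) (f g : 'M[bool]_n -> R) :
  graph_expectation M (fun A => f A + g A) =
  graph_expectation M f + graph_expectation M g.
Proof. by rewrite -big_split; apply: eq_bigr => A _; rewrite mulrDr. Qed.

Lemma graph_expectationZ (M : 'M[R]_n) (c : R) (f : 'M[bool]_n -> R) :
  graph_expectation M (fun A => c * f A) = c * graph_expectation M f.
Proof. by rewrite mulr_sumr; apply: eq_bigr => A _; rewrite mulrCA. Qed.

Lemma graph_expectation_ge0 (M : 'M[R]_n) (f : 'M[bool]_n -> R) :
  (forall i j, 0 <= M i j <= 1) -> (forall A, 0 <= f A) ->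
  0 <= graph_expectation M f.
Proof.
move=> M01 f0; apply: sumr_ge0 => A _; rewrite mulr_ge0 //.
by apply: prodr_ge0 => i _; apply: prodr_ge0 => j _; apply: bernoulli_pmf_ge0.
Qed.

Lemma prod_pairs (a : edges) (f : 'I_n * 'I_n -> R) : a \subset pairs ->
  \prod_(e in a) f e = \prod_(e in pairs) (if e \in a then f e else 1).
Proof.
move=> /fintype.subsetP aS; rewrite -big_mkcondr; apply: eq_bigl => e.
by apply/idP/andP => [ea|[]//]; rewrite aS.
Qed.

Definition spin (b : bool) : R := if b then 1 else -1.

Definition spins (b : edges) (A : 'M[bool]_n) : R :=
  \prod_(e in b) spin (A e.1 e.2).

(** Spins square to 1, so common edges cancel. The symmetric difference has at most [#|b| + #|c|]
    edges, which keeps degrees subadditive. *)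
Lemma spinsM (b c : edges) (A : 'M[bool]_n) :
  spins b A * spins c A = spins ((b :\: c) :|: (c :\: b)) A.
Proof.
rewrite /spins !(big_mkcond (fun e => e \in _)) -big_split /=.
apply: eq_bigr => e _; rewrite !inE /spin.
by case: (e \in b); case: (e \in c); case: (A _ _); rewrite /= ?mulr1 ?mul1r ?mulrNN ?mulr1.
Qed.

(* Equality is required on adjacency matrices only: symmetry is what reduces
   the [n * n] indeterminates to the entries above the diagonal. *)
Definition spin_span (D : nat) (f : 'M[bool]_n -> R) : Prop :=
  exists2 s : seq (R * edges),
    all (fun p : R * edges => (p.2 \subset pairs) && (#|p.2| <= D)%N) s &
    forall A, adjacency A -> f A = \sum_(p <- s) p.1 * spins p.2 A.

Lemma spin_span_eq D (f g : 'M[bool]_n -> R) :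
  (forall A, adjacency A -> f A = g A) -> spin_span D g -> spin_span D f.
Proof. by move=> fg [s sD sE]; exists s => // A A_adj; rewrite fg ?sE. Qed.

Lemma spin_span_leq D D' (f : 'M[bool]_n -> R) : (D <= D')%N ->
  spin_span D f -> spin_span D' f.
Proof.
move=> DD [s /allP sD sE]; exists s => //; apply/allP => p /sD /andP[-> pD].
exact: leq_trans pD DD.
Qed.

Lemma spin_span_cst D (c : R) : spin_span D (fun=> c).
Proof.
exists [:: (c, finset.set0)] => [|A _].
  by rewrite /= finset.sub0set finset.cards0.
by rewrite big_seq1 /spins finset.big_set0 mulr1.
Qed.

Lemma spin_spanD D (f g : 'M[bool]_n -> R) :
  spin_span D f -> spin_span D g -> spin_span D (fun A => f A + g A).
Proof.
move=> [s sD sE] [t tD tE]; exists (s ++ t) => [|A A_adj].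
  by rewrite all_cat sD tD.
by rewrite big_cat sE ?tE.
Qed.

Lemma spin_spanM D D' (f g : 'M[bool]_n -> R) :
  spin_span D f -> spin_span D' g -> spin_span (D + D') (fun A => f A * g A).
Proof.
move=> [s /allP sD sE] [t /allP tD tE].
exists [seq (p.1 * q.1, (p.2 :\: q.2) :|: (q.2 :\: p.2) : edges) | p <- s, q <- t].
  apply/allP => _ /allpairsP[[p q] /= [/sD /andP[pS pD] /tD /andP[qS qD] ->]] /=.
  apply/andP; split.
    rewrite finset.subUset !(fintype.subset_trans (finset.subsetDl _ _)) //.
  apply: leq_trans (leq_card_setU _ _) _.
  by rewrite leq_add // (leq_trans _ pD, leq_trans _ qD) // subset_leq_card ?finset.subsetDl.
move=> A A_adj; rewrite big_allpairs_dep sE ?tE // big_distrlr /=.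
apply: eq_bigr => p _; apply: eq_bigr => q _.
by rewrite -spinsM mulrACA.
Qed.

Lemma spin_spanX D m (f : 'M[bool]_n -> R) :
  spin_span D f -> spin_span (m * D) (fun A => f A ^+ m).
Proof.
move=> fD; elim: m => [|m IH].
  by apply: spin_span_eq (spin_span_cst _ 1) => A _; rewrite expr0.
by apply: spin_span_eq (spin_spanM fD IH) => A _; rewrite exprS.
Qed.

Lemma spin_span_prod (I : Type) (s : seq I) (d : I -> nat)
    (F : I -> 'M[bool]_n -> R) :
  (forall i, spin_span (d i) (F i)) ->
  spin_span (\sum_(i <- s) d i) (fun A => \prod_(i <- s) F i A).
Proof.
move=> Fd; elim: s => [|i s IH].
  by apply: spin_span_eq (spin_span_cst _ 1) => A _; rewrite big_nil.
rewrite big_cons; apply: spin_span_eq (spin_spanM (Fd i) IH) => A _.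
by rewrite big_cons.
Qed.

Lemma spin_span_sum (I : eqType) (s : seq I) D (F : I -> 'M[bool]_n -> R) :
  (forall i, i \in s -> spin_span D (F i)) ->
  spin_span D (fun A => \sum_(i <- s) F i A).
Proof.
elim: s => [|i s IH] FD.
  by apply: spin_span_eq (spin_span_cst _ 0) => A _; rewrite big_nil.
apply: spin_span_eq (spin_spanD (FD i (mem_head _ _)) (IH _)) => [A _|j js].
  by rewrite big_cons.
by apply: FD; rewrite inE js orbT.
Qed.

Lemma spin_span_entry (i j : 'I_n) : spin_span 1 (fun A => (A i j)%:R).
Proof.
have half e : e \in pairs -> spin_span 1 (fun A => (A e.1 e.2)%:R).
  move=> eS; exists [:: (2^-1, finset.set0); (2^-1, [set e])].
    by rewrite /= finset.sub0set finset.cards0 finset.cards1 finset.sub1set eS.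
  move=> A _; rewrite !big_cons big_nil /spins finset.big_set0 finset.big_set1 /spin.
  by case: (A _ _) => /=; lra.
case: (ltngtP i j) => ij.
- by apply: (half (i, j)); rewrite inE.
- apply: (@spin_span_eq _ _ (fun A => (A j i)%:R)).
    by move=> A /andP[/eqP As _]; rewrite [in LHS]As mxE.
  by apply: (half (j, i)); rewrite inE.
- apply: spin_span_eq (spin_span_cst _ 0) => A /andP[_ /forallP A0].
  by rewrite (val_inj ij) (negbTE (A0 j)).
Qed.

(** Each entry of [A] is affine in one spin or zero, and degrees add under products, so a monomial
    has spin degree at most its total degree. *)
Lemma spin_span_estimate D (P : 'M[{mpoly R[n * n]}]_n) (i j : 'I_n) :
  P \in low_degree R n D -> spin_span D (fun A => estimate P A i j).
Proof.
rewrite inE => /(_ i j) PD.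
pose v (A : 'M[bool]_n) := mxvec (map_mx (fun b : bool => b%:R : R) A) ord0.
apply: (@spin_span_eq _ _ (fun A => \sum_(m <- msupp (P i j))
    (P i j)@_m * \prod_l v A l ^+ m l)) => [A _|].
  by rewrite /estimate mxE mevalE.
apply: spin_span_sum => m mP; rewrite -[D]add0n.
apply: spin_spanM; first exact: spin_span_cst.
apply: (@spin_span_leq (mdeg m)); first by rewrite -ltnS (leq_trans (msize_mdeg_lt mP)).
rewrite mdegE; apply: spin_span_prod => l; rewrite -[X in spin_span X _]muln1.
apply: spin_spanX; case/mxvec_indexP: l => a b.
by apply: spin_span_eq (spin_span_entry a b) => A _; rewrite /v mxvecE mxE.
Qed.

End GraphExpectation.

(** * The planted partition prior and the dual function *)

Section PlantedPartition.
Variables (R : realType) (n k : nat) (theta : R).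
Hypotheses (theta_ge0 : 0 <= theta) (theta_le : theta ^+ 2 <= 2^-1).

Local Notation colouring := 'rV['I_k.+1]_n.
Local Notation edges := {set 'I_n * 'I_n}.
Local Notation P := (@mono_prob R n k).

Definition planted (z : colouring) : 'M[R]_n :=
  \matrix_(i, j) if i == j then 0 else
    2^-1 + theta / 2 * (mono z (i, j))%:R.

Definition signal (z : colouring) (e : 'I_n * 'I_n) : R :=
  theta * (mono z e)%:R.

Lemma signal_sq (z : colouring) e : 0 <= signal z e ^+ 2 <= 2^-1.
Proof.
rewrite /signal; case: (mono z e); rewrite ?mulr1 ?mulr0.
  by rewrite theta_le exprn_ge0.
by rewrite expr0n /= lexx invr_ge0 ler0n.
Qed.

Let theta_le1 : theta <= 1.
Proof. by rewrite -(@expr_le1 _ 2) //; apply: le_trans theta_le _; lra. Qed.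

Lemma planted01 (z : colouring) i j : 0 <= planted z i j <= 1.
Proof.
rewrite mxE; case: eqP => _; first by rewrite lexx ler01.
by case: mono; rewrite ?mulr1 ?mulr0; apply/andP; split; move: theta_ge0 theta_le1; lra.
Qed.

Lemma plantedE (z : colouring) e : e \in pairs n ->
  planted z e.1 e.2 = 2^-1 * (1 + signal z e).
Proof.
case: e => i j; rewrite inE /= => ij; rewrite mxE.
by rewrite (_ : (i == j) = false) /signal; [lra|apply/negbTE; rewrite neq_ltn ij].
Qed.

(** Normalised so that, given [z], each factor has mean 0, covariance 1 with its own spin, and
    variance [(1 - signal z e ^+ 2)^-1]. *)
Definition centred_spins (z : colouring) (a : edges) (A : 'M[bool]_n) : R :=
  \prod_(e in a) ((spin R (A e.1 e.2) - signal z e) / (1 - signal z e ^+ 2)).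

Local Notation expect z := (graph_expectation (planted z)).

(** By independence each edge contributes a factor: 1 if in both sets or in neither, the signal if
    only in [b], and 0 if only in [a]. *)
Lemma expect_spins_centred (z : colouring) (a b : edges) :
  a \subset pairs n -> b \subset pairs n ->
  expect z (fun A => spins R b A * centred_spins z a A) =
  if a \subset b then \prod_(e in b :\: a) signal z e else 0.
Proof.
move=> aS bS.
pose F e c : R := (if e \in b then spin R c else 1) *
  (if e \in a then (spin R c - signal z e) / (1 - signal z e ^+ 2) else 1).
rewrite (@eq_graph_expectation _ _ _ _
  (fun A => \prod_(e in pairs n) F e (A e.1 e.2))); last first.
  by move=> A _; rewrite /spins /centred_spins !(prod_pairs _ aS) (prod_pairs _ bS) -big_split.
rewrite graph_expectation_pairs.
have Fv e : e \in pairs n ->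
    planted z e.1 e.2 * F e true + (1 - planted z e.1 e.2) * F e false =
    if e \in a then (e \in b)%:R else if e \in b then signal z e else 1.
  move=> /plantedE ->; have := signal_sq z e; rewrite /F /spin.
  move: (signal z e) => x x1; have x2 : 1 - x ^+ 2 != 0 by apply/eqP; lra.
  by case: (e \in a); case: (e \in b) => /=; field.
rewrite (eq_bigr _ Fv); case: ifPn => [ab|/fintype.subsetPn[e ea eb]].
  rewrite (@prod_pairs _ _ (b :\: a)); last first.
    exact: fintype.subset_trans (finset.subsetDl _ _) bS.
  apply: eq_bigr => e _; rewrite finset.in_setD.
  by case: ifP => //= ea; rewrite (fintype.subsetP ab).
by rewrite (bigD1 e) ?(fintype.subsetP aS) //= ea (negbTE eb) mul0r.
Qed.

Lemma expect_spins (z : colouring) (b : edges) : b \subset pairs n ->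
  expect z (fun A => spins R b A) = \prod_(e in b) signal z e.
Proof.
move=> bS; have := expect_spins_centred z (finset.sub0set _) bS.
rewrite finset.sub0set finset.setD0 => <-; apply: eq_graph_expectation => A _.
by rewrite /centred_spins finset.big_set0 mulr1.
Qed.

Lemma expect_centred_centred (z : colouring) (a b : edges) :
  a \subset pairs n -> b \subset pairs n ->
  expect z (fun A => centred_spins z a A * centred_spins z b A) =
  if a == b then \prod_(e in a) (1 - signal z e ^+ 2)^-1 else 0.
Proof.
move=> aS bS.
pose G e c : R := (spin R c - signal z e) / (1 - signal z e ^+ 2).
pose F e c : R := (if e \in a then G e c else 1) * (if e \in b then G e c else 1).
rewrite (@eq_graph_expectation _ _ _ _
  (fun A => \prod_(e in pairs n) F e (A e.1 e.2))); last first.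
  by move=> A _; rewrite /centred_spins (prod_pairs _ aS) (prod_pairs _ bS) -big_split.
rewrite graph_expectation_pairs.
have Fv e : e \in pairs n ->
    planted z e.1 e.2 * F e true + (1 - planted z e.1 e.2) * F e false =
    if (e \in a) == (e \in b) then
      if e \in a then (1 - signal z e ^+ 2)^-1 else 1 else 0.
  move=> /plantedE ->; have := signal_sq z e; rewrite /F /G /spin.
  move: (signal z e) => x x1; have x2 : 1 - x ^+ 2 != 0 by apply/eqP; lra.
  by case: (e \in a); case: (e \in b) => /=; field.
rewrite (eq_bigr _ Fv); case: ifPn => [/eqP <-|ab].
  by rewrite (prod_pairs _ aS); apply: eq_bigr => e _; rewrite eqxx.
have [e eab] : exists e, (e \in a) != (e \in b).
  apply/existsP; apply: contraNT ab; rewrite negb_exists => /forallP abE.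
  by apply/eqP/setP => e; apply/eqP; have := abE e; rewrite negbK.
have eS : e \in pairs n.
  by apply: contraNT eab => eS; rewrite !(contraNF (fintype.subsetP _ e) eS).
by rewrite (bigD1 e) //= (negbTE eab) mul0r.
Qed.

Definition mean (f : colouring -> R) : R :=
  (k.+1 ^ n)%:R^-1 * \sum_z f z.

Definition joint_expect (F : colouring -> 'M[bool]_n -> R) : R :=
  mean (fun z => expect z (F z)).

Lemma mean_sum (I : Type) (s : seq I) (Q : pred I) (F : I -> colouring -> R) :
  mean (fun z => \sum_(i <- s | Q i) F i z) = \sum_(i <- s | Q i) mean (F i).
Proof. by rewrite /mean exchange_big mulr_sumr. Qed.

Lemma meanZ (c : R) (f : colouring -> R) : mean (fun z => c * f z) = c * mean f.
Proof. by rewrite /mean -mulr_sumr mulrCA. Qed.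

Lemma meanD (f g : colouring -> R) :
  mean (fun z => f z + g z) = mean f + mean g.
Proof. by rewrite /mean big_split mulrDr. Qed.

Lemma eq_mean (f g : colouring -> R) : f =1 g -> mean f = mean g.
Proof. by move=> fg; congr (_ * _); apply: eq_bigr => z _; rewrite fg. Qed.

Lemma ler_mean (f g : colouring -> R) : (forall z, f z <= g z) -> mean f <= mean g.
Proof. by move=> fg; rewrite ler_wpM2l ?invr_ge0 // ler_sum. Qed.

Lemma mean_cst (c : R) : mean (fun=> c) = c.
Proof.
rewrite /mean sumr_const card_colouring -[c *+ _]mulr_natl mulrA mulVf ?mul1r //.
Qed.

Lemma eq_joint_expect F G :
  (forall z A, adjacency A -> F z A = G z A) -> joint_expect F = joint_expect G.
Proof. by move=> FG; apply: eq_mean => z; apply: eq_graph_expectation => A /FG. Qed.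

Lemma joint_expect_ge0 F : (forall z A, 0 <= F z A) -> 0 <= joint_expect F.
Proof.
move=> F0; rewrite -[leLHS](mean_cst 0); apply: ler_mean => z.
by apply: graph_expectation_ge0 => //; apply: planted01.
Qed.

Lemma joint_expectD F G :
  joint_expect (fun z A => F z A + G z A) = joint_expect F + joint_expect G.
Proof. by rewrite -meanD; apply: eq_mean => z; rewrite graph_expectationD. Qed.

Lemma joint_expectZ c F :
  joint_expect (fun z A => c * F z A) = c * joint_expect F.
Proof. by rewrite -meanZ; apply: eq_mean => z; rewrite graph_expectationZ. Qed.

Lemma joint_expect_sum (I : Type) (s : seq I) (Q : pred I)
    (F : I -> colouring -> 'M[bool]_n -> R) :
  joint_expect (fun z A => \sum_(i <- s | Q i) F i z A) =
  \sum_(i <- s | Q i) joint_expect (F i).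
Proof.
rewrite -mean_sum; apply: eq_mean => z; rewrite exchange_big /=.
by apply: eq_bigr => A _; rewrite mulr_sumr.
Qed.

Lemma prod_signal (z : colouring) (b : edges) :
  \prod_(e in b) signal z e = theta ^+ #|b| * (z \in monos k b)%:R.
Proof.
rewrite /signal big_split /= prodr_const; congr (_ * _).
case: (boolP (z \in monos k b)) => [/monosP zb|].
  by rewrite big1 // => e /zb ->.
rewrite inE negb_forall => /existsP[e]; rewrite negb_imply => /andP[eb /negbTE ze].
by rewrite (bigD1 e) //= ze mul0r.
Qed.

Lemma mean_monos (b : edges) : mean (fun z => (z \in monos k b)%:R) = P b.
Proof.
rewrite /mean mulrC /mono_prob; congr (_ / _).
by rewrite -sum1_card natr_sum [RHS]big_mkcond /=; apply: eq_bigr => z _; case: ifP.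
Qed.

Lemma mean_signal (b : edges) :
  mean (fun z => \prod_(e in b) signal z e) = theta ^+ #|b| * P b.
Proof. by rewrite -mean_monos -meanZ; apply: eq_mean => z; rewrite prod_signal. Qed.

Section Target.
Variables (e0 : 'I_n * 'I_n) (D : nat).
Hypothesis e0S : e0 \in pairs n.

Local Notation cumulant := (cumulant R k e0).
Local Notation low a := ((a \subset pairs n) && (#|a| <= D)%N).

Definition target (z : colouring) : R := (mono z e0)%:R.

Lemma mean_target_signal (b : edges) :
  mean (fun z => target z * \prod_(e in b) signal z e) =
  theta ^+ #|b| * P (e0 |: b).
Proof.
rewrite -mean_monos -meanZ; apply: eq_mean => z.
rewrite prod_signal mulrCA -natrM mulnb monosU finset.in_setI; congr (_ * (_ && _)%:R).
apply/idP/monosP => [ze e /finset.set1P -> //|]; apply; exact: finset.set11.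
Qed.

(* The function h of the introductory comment. *)
Definition dual (z : colouring) (A : 'M[bool]_n) : R :=
  \sum_(a : edges | low a) theta ^+ #|a| * cumulant a * centred_spins z a A.

(** Only the terms with [a \subset b] survive, and the powers of [theta] combine to [theta ^+ #|b|];
    what remains is the moment-cumulant formula [sum_cumulant]. *)
Lemma joint_expect_spins_dual (b : edges) : low b ->
  joint_expect (fun z A => spins R b A * dual z A) =
  joint_expect (fun z A => spins R b A * target z).
Proof.
move=> /andP[bS bD].
transitivity (theta ^+ #|b| * P (e0 |: b)); last first.
  rewrite -mean_target_signal; apply: eq_mean => z.
  by rewrite -expect_spins // -graph_expectationZ; apply: eq_graph_expectation => A _; rewrite mulrC.
rewrite (@eq_joint_expect _ (fun z A => \sum_(a : edges | low a)
    theta ^+ #|a| * cumulant a * (spins R b A * centred_spins z a A))); last first.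
  by move=> z A _; rewrite mulr_sumr; apply: eq_bigr => a _; rewrite mulrCA.
rewrite joint_expect_sum -sum_cumulant mulr_sumr.
rewrite (bigID (fun a : edges => a \subset b)) /= [X in _ + X]big1 ?addr0; last first.
  move=> a /andP[/andP[aS _] /negbTE ab]; rewrite joint_expectZ.
  rewrite (_ : joint_expect _ = 0) ?mulr0 // -[RHS](mean_cst 0); apply: eq_mean => z.
  by rewrite expect_spins_centred // ab.
apply: eq_big => a.
  apply/andP/idP => [[]//|ab]; rewrite (fintype.subset_trans ab bS) ab.
  by rewrite (leq_trans (subset_leq_card ab)).
move=> /andP[/andP[aS _] ab]; rewrite joint_expectZ.
rewrite (_ : joint_expect _ = theta ^+ #|b :\: a| * P (b :\: a)); last first.
  by rewrite -mean_signal; apply: eq_mean => z; rewrite expect_spins_centred // ab.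
rewrite mulrACA -exprD; congr (_ ^+ _ * _).
by rewrite -(cardsID a b) (finset.setIidPr ab).
Qed.

Lemma joint_expect_dual (f : 'M[bool]_n -> R) : spin_span D f ->
  joint_expect (fun z A => f A * (dual z A - target z)) = 0.
Proof.
move=> [s /allP sD sE].
rewrite (@eq_joint_expect _ (fun z A => \sum_(p <- s)
    p.1 * (spins R p.2 A * dual z A + -1 * (spins R p.2 A * target z)))); last first.
  by move=> z A /sE ->; rewrite mulr_suml; apply: eq_bigr => p _; ring.
rewrite joint_expect_sum big_seq big1 // => p /sD pD.
by rewrite joint_expectZ joint_expectD joint_expectZ joint_expect_spins_dual // mulN1r subrr mulr0.
Qed.

(** Orthogonality given [z] leaves the diagonal terms, and [signal_sq] bounds each edge's variance
    by 2. *)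
Lemma joint_expect_dual_sq :
  joint_expect (fun z A => dual z A ^+ 2) <=
  \sum_(a : edges | (#|a| <= D)%N) (2 * theta ^+ 2) ^+ #|a| * cumulant a ^+ 2.
Proof.
rewrite (@eq_joint_expect _ (fun z A => \sum_(a : edges | low a)
    \sum_(b : edges | low b)
      (theta ^+ #|a| * cumulant a) * (theta ^+ #|b| * cumulant b) *
      (centred_spins z a A * centred_spins z b A))); last first.
  move=> z A _; rewrite expr2 [LHS]big_distrlr /=.
  by apply: eq_bigr => a _; apply: eq_bigr => b _; rewrite mulrACA.
have tau0 : 0 <= 2 * theta ^+ 2 by rewrite mulr_ge0 ?exprn_ge0.
rewrite joint_expect_sum [leRHS](bigID (fun a : edges => a \subset pairs n)) /=.
rewrite -[leLHS]addr0; apply: lerD; last first.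
  by apply: sumr_ge0 => a _; apply: mulr_ge0; [exact: exprn_ge0|exact: sqr_ge0].
rewrite (eq_bigl (fun a : edges => (#|a| <= D)%N && (a \subset pairs n))); last first.
  by move=> a; rewrite andbC.
apply: ler_sum => a /andP[aD aS].
rewrite joint_expect_sum (bigD1 a) ?aD ?aS //= [X in _ + X]big1 ?addr0; last first.
  move=> b /andP[/andP[bS _] ba]; rewrite joint_expectZ.
  rewrite (_ : joint_expect _ = 0) ?mulr0 // -[RHS](mean_cst 0); apply: eq_mean => z.
  by rewrite expect_centred_centred // eq_sym (negbTE ba).
have -> : (2 * theta ^+ 2) ^+ #|a| = 2 ^+ #|a| * theta ^+ 2 ^+ #|a| by rewrite exprMn.
rewrite joint_expectZ -expr2 [in leLHS]exprMn -(exprM _ #|a|) mulnC exprM.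
rewrite [leLHS]mulrC -[leRHS]mulrA.
apply: ler_wpM2r; first by apply: mulr_ge0; [rewrite exprn_ge0 ?exprn_ge0|exact: sqr_ge0].
rewrite -[leRHS]mean_cst; apply: ler_mean => z; rewrite expect_centred_centred // eqxx.
rewrite -prodr_const; apply: ler_prod => e _; have := signal_sq z e.
move: (signal z e ^+ 2) => x x1; have x2 : 0 < 1 - x by lra.
by rewrite invr_ge0 ltW //= -div1r ler_pdivrMr //; lra.
Qed.

Lemma joint_expect_low_degree (f : 'M[bool]_n -> R) : spin_span D f ->
  (0 < D)%N -> (k.+1 ^ 2 <= 2 * n)%N ->
  1536 * theta ^+ 2 * D%:R ^+ 4 * n%:R / k.+1%:R ^+ 2 <= 1 ->
  k.+1%:R^-1 - 4 / 3 / k.+1%:R ^+ 2 <=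
  joint_expect (fun z A => (f A - target z) ^+ 2).
Proof.
move=> fD D0 kn thetaD.
have e0N : e0.1 != e0.2 by move: e0S; rewrite inE neq_ltn => ->.
have tau0 : 0 <= 2 * theta ^+ 2 by rewrite mulr_ge0 ?exprn_ge0.
(* [sum_cumulant_sq] is applied with [tau = 2 * theta ^+ 2], whence 1536 = 2 * 768. *)
have tauD : 2 * theta ^+ 2 * (768 * D%:R ^+ 4 * n%:R / k.+1%:R ^+ 2) <= 1.
  by apply: le_trans thetaD; rewrite le_eqVlt; apply/orP/or_introl/eqP; field;
    rewrite nat1r pnatr_eq0.
have := sum_cumulant_sq tau0 D0 e0N kn tauD.
move=> /(le_trans joint_expect_dual_sq) dual_le.
have target_sq : joint_expect (fun z _ => target z) = k.+1%:R^-1.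
  have := mean_target_signal finset.set0.
  rewrite finset.setU0 finset.cards0 expr0 mul1r mono_prob1 // => <-.
  apply: eq_mean => z; rewrite finset.big_set0 mulr1.
  have := expect_spins z (finset.sub0set _); rewrite finset.big_set0 => spins0.
  rewrite -[RHS]mulr1 -[in RHS]spins0 -graph_expectationZ.
  by apply: eq_graph_expectation => A _; rewrite /spins finset.big_set0 mulr1.
(* Complete the square around [dual], using [target ^+ 2 = target]; the cross term has expectation 0
   by [joint_expect_dual]. *)
rewrite (@eq_joint_expect _ (fun z A => (f A - dual z A) ^+ 2 +
    (2 * (f A * (dual z A - target z)) + (-1 * dual z A ^+ 2 + target z)))); last first.
  move=> z A _; rewrite -[X in _ + (_ + (_ + X))](_ : target z ^+ 2 = target z); first by ring.
  by rewrite /target; case: mono; rewrite ?expr1n ?expr0n.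
rewrite !joint_expectD !joint_expectZ joint_expect_dual // target_sq.
have : 0 <= joint_expect (fun z A => (f A - dual z A) ^+ 2).
  by apply: joint_expect_ge0 => z A; apply: sqr_ge0.
rewrite mulr0 add0r mulN1r [- _ + _]addrC => sq_ge0; rewrite -[leLHS]add0r.
by rewrite lerD // lerD2l lerN2.
Qed.

End Target.

End PlantedPartition.

(** * From the average over the prior to the risk at one matrix *)

Lemma card_pairs (n : nat) : #|pairs n| = 'C(n, 2).
Proof.
rewrite -sum1_card (eq_bigl (fun e : 'I_n * 'I_n => true && (e.1 < e.2)%N)); last first.
  by move=> e; rewrite inE.
rewrite -(pair_big_dep predT (fun i j : 'I_n => (i < j)%N) (fun _ _ => 1%N)) /=.
rewrite (exchange_big_dep predT) //= -bin2_sum big_mkord.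
apply: eq_bigr => j _.
by rewrite -(big_ord_widen n (fun=> 1%N) (ltnW (ltn_ord j))) sum1_card card_ord.
Qed.

(** Only the first [k.+1] of the [k'] communities are occupied. *)
Lemma planted_SBM (R : realType) (n k k' : nat) (theta : R) (z : 'rV['I_k.+1]_n) :
  0 <= theta -> theta ^+ 2 <= 2^-1 -> (k.+1 <= k')%N ->
  SBM R n k' (planted theta z).
Proof.
move=> theta0 theta2 kk'; split; first exact: planted01.
split; first by move=> i; rewrite mxE eqxx.
have theta1 : theta <= 1 by rewrite -(@expr_le1 _ 2) //; apply: le_trans theta2 _; lra.
exists (\matrix_(a, b) (2^-1 + theta / 2 * (a == b)%:R)).
exists (fun i => widen_ord kk' (z ord0 i)); split.
- by apply/matrixP => a b; rewrite !mxE eq_sym.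
- by move=> a b; rewrite mxE; case: (a == b); rewrite ?mulr1 ?mulr0; lra.
- move=> i j ij; rewrite /planted !mxE (negbTE ij) [j == i]eq_sym (negbTE ij) /mono /=.
  by split; rewrite ?[z ord0 j == _]eq_sym; congr (_ + _ * (_)%:R).
Qed.

Section PlantedRisk.
Variables (R : realType) (n k : nat) (theta : R).
Hypotheses (theta_ge0 : 0 <= theta) (theta_le : theta ^+ 2 <= 2^-1).

Lemma mean_risk (P : 'M[{mpoly R[n * n]}]_n) :
  mean (fun z : 'rV['I_k.+1]_n => risk P (planted theta z)) =
  'C(n, 2)%:R^-1 * \sum_(e in pairs n) joint_expect theta (fun (z : 'rV['I_k.+1]_n) A =>
    (estimate P A e.1 e.2 - planted theta z e.1 e.2) ^+ 2).
Proof.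
rewrite -joint_expect_sum -joint_expectZ; apply: eq_joint_expect => z A _.
rewrite /loss pair_big_dep /=; congr (_ * _).
by apply: eq_bigl => e; rewrite inE.
Qed.

Lemma planted_risk (P : 'M[{mpoly R[n * n]}]_n) (D : nat) :
  low_degree R n D P -> (0 < D)%N -> (0 < k)%N -> (2 <= n)%N ->
  (k.+1 ^ 2 <= 2 * n)%N ->
  1536 * theta ^+ 2 * D%:R ^+ 4 * n%:R / k.+1%:R ^+ 2 <= 1 ->
  exists z : 'rV['I_k.+1]_n, theta ^+ 2 / (12 * k.+1%:R) <= risk P (planted theta z).
Proof.
move=> PD D0 k0 n2 kn thetaD.
have C0 : 0 < 'C(n, 2)%:R :> R by rewrite ltr0n bin_gt0.
(* The rescaling below divides by [theta]; at [theta = 0] the claimed bound is 0. *)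
have [theta0|theta_neq0] := eqVneq theta 0.
  exists 0; rewrite theta0 expr0n mul0r; apply: graph_expectation_ge0.
    by apply: planted01; rewrite ?expr0n ?invr_ge0.
  move=> A; rewrite mulr_ge0 ?invr_ge0 ?ler0n //.
  by apply: sumr_ge0 => i _; apply: sumr_ge0 => j _; apply: sqr_ge0.
have K2 : 2 <= k.+1%:R :> R by rewrite ler_nat.
have entry e : e \in pairs n -> theta ^+ 2 / (12 * k.+1%:R) <=
    joint_expect theta (fun (z : 'rV['I_k.+1]_n) A =>
      (estimate P A e.1 e.2 - planted theta z e.1 e.2) ^+ 2).
  (* The affine change that turns the matrix entry into the 0-1 target; it preserves the degree and
     scales the squared error by [theta ^+ 2 / 4]. *)
  move=> eS; pose f A := 2 / theta * (estimate P A e.1 e.2 - 2^-1).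
  have fD : spin_span D f.
    rewrite -[D]add0n; apply: spin_spanM; first exact: spin_span_cst.
    apply: spin_spanD; last exact: spin_span_cst.
    by apply: spin_span_estimate; rewrite inE.
  have := joint_expect_low_degree theta_ge0 theta_le eS fD D0 kn thetaD.
  rewrite (@eq_joint_expect _ _ _ _ (fun (z : 'rV['I_k.+1]_n) A =>
    (estimate P A e.1 e.2 - planted theta z e.1 e.2) ^+ 2)
    (fun (z : 'rV['I_k.+1]_n) A => theta ^+ 2 / 4 * (f A - target R e z) ^+ 2)).
    rewrite joint_expectZ => le_f.
    apply: le_trans (ler_wpM2l _ le_f); last by rewrite mulr_ge0 ?exprn_ge0.
    have -> : theta ^+ 2 / (12 * k.+1%:R) = theta ^+ 2 / 4 * (k.+1%:R^-1 / 3).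
      by field; rewrite nat1r pnatr_eq0.
    rewrite ler_wpM2l ?mulr_ge0 ?exprn_ge0 //.
    (* With [x = k.+1%:R^-1 <= 1/2], [x - 4 / 3 * x ^+ 2 >= x / 3]; this 3 and the 4 of the
       rescaling make 12. *)
    rewrite -exprVn; have : k.+1%:R^-1 <= 2^-1 :> R by rewrite lef_pV2 ?posrE.
    by have : 0 <= k.+1%:R^-1 :> R by []; move: (k.+1%:R^-1 : R) => x; nra.
  move=> z A _; rewrite plantedE // /signal /f /target.
  by field.
(* Some [z] has at least the average risk, since otherwise the average would be strictly below the
   bound. *)
apply: contrapT => /forallNP risk_lt.
suff : theta ^+ 2 / (12 * k.+1%:R) < theta ^+ 2 / (12 * k.+1%:R) by rewrite ltxx.
apply: (@le_lt_trans _ _ (mean (fun z : 'rV['I_k.+1]_n => risk P (planted theta z)))).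
  rewrite mean_risk [leRHS]mulrC ler_pdivlMr // -card_pairs.
  rewrite [leLHS]mulr_natr -[leLHS]sumr_const; apply: ler_sum => e eS; exact: entry.
rewrite -[X in _ < X](@mean_cst R n k) /mean ltr_pM2l ?invr_gt0 ?ltr0n ?expn_gt0 //.
apply: ltr_sum => [|z _]; last by rewrite ltNge; apply/negP/risk_lt.
by apply/hasP; exists 0; rewrite ?mem_index_enum.
Qed.

End PlantedRisk.

(** * Choice of the parameters and conclusion *)

Lemma class_number (R : realType) (n k : nat) : (2 <= n)%N -> (2 <= k)%N ->
  exists2 m, [/\ (0 < m)%N, (m.+1 <= k)%N & (m.+1 ^ 2 <= 2 * n)%N] &
    Num.min (k%:R / n%:R) k%:R^-1 <= m.+1%:R / n%:R :> R.
Proof.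
move=> n2 k2; have n0 : 0 < n%:R :> R by rewrite ltr0n; lia.
pose p m := [&& (0 < m)%N, (m.+1 <= k)%N & (m.+1 ^ 2 <= 2 * n)%N].
(* The bound [2 * n], rather than [n], admits two colours already at [n = 2]. *)
have p1 : exists m, p m by exists 1%N; rewrite /p k2 /=; lia.
have pk m : p m -> (m <= k)%N by move=> /and3P[_ /ltnW].
case: (ex_maxnP p1 pk) => m /and3P[m0 mk mn] mmax; exists m => //.
rewrite ge_min; case: (ltngtP m.+1 k) mk => // [mk _|-> _]; last by rewrite lexx.
apply/orP; right; rewrite ler_pdivlMr // mulrC ler_pdivrMr ?ltr0n; last lia.
rewrite -natrM ler_nat.
(* Here [m.+2 <= k], so maximality means [m.+2 ^ 2 > 2 * n]; as [m.+2 <= 2 * m.+1], this gives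
   [n <= m.+1 * m.+2 <= m.+1 * k]. *)
have : ~~ p m.+1 by apply/negP => /mmax; rewrite ltnn.
rewrite /p mk /= -ltnNge -mulnn; nia.
Qed.

Local Open Scope classical_set_scope.

Theorem corollary1 (R : realType) :
  exists2 c : R, 0 < c &
    forall n k D : nat, (2 <= n)%N -> (2 <= k)%N -> (1 <= D)%N ->
      ((c / D%:R ^+ 4 * Num.min (k%:R / n%:R) (k%:R^-1))%:E <=
       ereal_inf [set ereal_sup [set (risk P M)%:E | M in SBM R n k]
                 | P in low_degree R n D])%E.
Proof.
(* 12 is the loss in [planted_risk], and 1536 comes from the constraint on [theta ^+ 2]. *)
exists (12 * 1536)^-1; first by rewrite invr_gt0 mulr_gt0 ?ltr0n.
move=> n k D n2 k2 D1.
have [m [m0 mk mn] minm] := class_number R n2 k2.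
have n_gt0 : (0 < n)%N := ltnW n2.
have n0 : 0 < n%:R :> R by rewrite ltr0n.
have D_gt0 : 0 < D%:R :> R by rewrite ltr0n.
have D0 : 0 < D%:R ^+ 4 :> R by rewrite exprn_gt0.
have K0 : 0 < 1 + m%:R :> R by rewrite nat1r.
(* The value of [theta ^+ 2] that makes the constraint of [planted_risk] an equality. *)
pose s : R := m.+1%:R ^+ 2 / (1536 * D%:R ^+ 4 * n%:R).
have s0 : 0 <= s by rewrite divr_ge0 ?mulr_ge0 ?exprn_ge0 ?ler0n.
have theta2 : Num.sqrt s ^+ 2 = s by rewrite sqr_sqrtr.
have s2 : s <= 2^-1.
  rewrite ler_pdivrMr ?mulr_gt0 ?ltr0n //.
  have : m.+1%:R ^+ 2 <= 2 * n%:R :> R by rewrite -natrX -natrM ler_nat.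
  have : 1 <= D%:R ^+ 4 :> R by rewrite exprn_ege1 // ler1n.
  by move: (D%:R ^+ 4) (n%:R) (m.+1%:R ^+ 2) n0 => x y w; nra.
apply: le_ereal_inf_tmp => _ [P PD <-].
have theta_le : Num.sqrt s ^+ 2 <= 2^-1 by rewrite theta2.
have thetaD : 1536 * Num.sqrt s ^+ 2 * D%:R ^+ 4 * n%:R / m.+1%:R ^+ 2 <= 1.
  rewrite theta2 le_eqVlt /s; apply/orP/or_introl/eqP; field.
  by rewrite !gt_eqF.
have [z zrisk] := planted_risk (sqrtr_ge0 s) theta_le PD D1 m0 n2 mn thetaD.
apply: (@le_trans _ _ (risk P (planted (Num.sqrt s) z))%:E); last first.
  apply: ereal_sup_ubound; exists (planted (Num.sqrt s) z) => //.
  by apply: planted_SBM mk; rewrite ?sqrtr_ge0 ?theta2.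
rewrite lee_fin; apply: le_trans zrisk; rewrite theta2.
have -> : s / (12 * m.+1%:R) = (12 * 1536)^-1 / D%:R ^+ 4 * (m.+1%:R / n%:R).
  by rewrite /s; field; rewrite !gt_eqF.
apply: ler_wpM2l minm; apply: divr_ge0; last exact: ltW.
by rewrite invr_ge0 mulr_ge0 ?ler0n.
Qed.
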